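(* Let $M\subset\mathbb{R}^m$ be open. For $i=1,\dots,n$ let $P_i$ be a one-dimensional probability density function on a domain $X_i\subset\mathbb{R}$, let $h^i:M\to\mathbb{R}$ be differentiable, let $e_i\in\mathbb{N}^{+}$, and suppose that $X_i$ is unchanged under the change of variables $y^i=x^i-h^i(\theta)$ for all $i$ and all $\theta\in M$. Then the family $$P(x;\theta)=\bigodot_{i=1}^n P_i\big(x^i-h^i(\theta)\big)^{\odot e_i}$$ has Fisher information metric $$g_{ab}(P)=\sum_{i,j=1}^n(\partial_a h^i)(\partial_b h^j)D_{ij},$$ where $$D_{ij}=\begin{cases} e_i\displaystyle\int_{X_i}\Big(\frac{\partial P_i(x^i)}{\partial x^i}\Big)\Big(\frac{\partial\ln P_i(x^i)}{\partial x^i}\Big)\mathrm{d}x^i, & i=j,\\ 0, & i\neq j.\end{cases}$$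
   Context: Here $\partial_a=\partial/\partial\theta^a$ for coordinates $\theta=(\theta^1,\dots,\theta^m)$ on $M$. A domain in $\mathbb{R}$ is a nonempty connected open set. A one-dimensional probability density function on $X_i$ is a nonnegative function on $X_i$ with integral $1$; here each $P_i$ is continuously differentiable on $X_i$, and the integrals defining $D_{ii}$ are assumed finite. The Fisher information metric of a family $P(x;\theta)$, $x\in X$, $\theta\in M$, of probability density functions is $$g_{ab}(P)(\theta)=\int_X P(x;\theta)\,\partial_a\ln P(x;\theta)\,\partial_b\ln P(x;\theta)\,\mathrm{d}x .$$ Integrands containing a logarithmic derivative of a density are taken to be $0$ where that density vanishes. The spatially disjoint product $\bigodot$ of families of densities over the same parameter set $M$ is the product of the densities in separate spatial variables, and $Q^{\odot e}$ is the spatially disjoint product of $e$ copies of $Q$. Thus here, explicitly, with variables $x^{i,k}\in X_i$ ($1\le i\le n$, $1\le k\le e_i$), $$P(x;\theta)=\prod_{i=1}^n\prod_{k=1}^{e_i}P_i\big(x^{i,k}-h^i(\theta)\big).$$ *)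

(* Defs.v *)
From HB Require Import structures.
From mathcomp Require Import all_boot all_order all_algebra.
From mathcomp Require Import all_classical all_reals all_analysis.
Import Order.TTheory GRing.Theory Num.Theory.
Import numFieldNormedType.Exports.

Set Implicit Arguments.
Unset Strict Implicit.
Unset Printing Implicit Defensive.

Local Open Scope classical_set_scope.
Local Open Scope ring_scope.

(* Lebesgue measure on R^N, carried by N.-tuple with its product sigma-algebra:
   the image of lebesgue_measure \x (Lebesgue measure on R^(N-1)) under
   (x, t) |-> x :: t, starting from the unit mass on R^0.                     *)
Section cons_measure.
Context {R : realType} (N : nat).
Local Notation T := (measurableTypeR R).
Variable mu : {sigma_finite_measure set (N.-tuple T) -> \bar R}.

Definition cons_pair (p : T * N.-tuple T) : N.+1.-tuple T :=
  [the N.+1.-tuple T of p.1 :: p.2].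

Lemma measurable_cons_pair : measurable_fun [set: T * N.-tuple T] cons_pair.
Proof. exact: measurable_cons. Qed.

Definition cons_measure : set (N.+1.-tuple T) -> \bar R :=
  pushforward (@lebesgue_measure R \x mu)%E cons_pair.

Let cons_measure_preim (A : set (N.+1.-tuple T)) :
  measurable A -> measurable (cons_pair @^-1` A).
Proof. by move=> mA; rewrite -[X in measurable X]setTI; exact: measurable_cons_pair. Qed.

Let cons_measure0 : cons_measure set0 = 0%E.
Proof. by rewrite /cons_measure /pushforward preimage_set0 measure0. Qed.

Let cons_measure_ge0 A : (0 <= cons_measure A)%E.
Proof. by rewrite /cons_measure /pushforward measure_ge0. Qed.

Let cons_measure_sigma_additive : semi_sigma_additive cons_measure.
Proof.
move=> F mF tF mUF; rewrite /cons_measure /pushforward preimage_bigcup.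
apply: measure_semi_sigma_additive.
- by move=> n; exact: cons_measure_preim.
- apply/trivIsetP => /= i j _ _ ij; rewrite -preimage_setI.
  by move/trivIsetP : tF => /(_ _ _ _ _ ij) ->//; rewrite preimage_set0.
- by rewrite -preimage_bigcup; exact: cons_measure_preim.
Qed.

HB.instance Definition _ := isMeasure.Build _ _ _ cons_measure
  cons_measure0 cons_measure_ge0 cons_measure_sigma_additive.

Let uncons (x : N.+1.-tuple T) : T * N.-tuple T :=
  (thead x, [tuple of behead x]).

Let cons_pairK : cancel cons_pair uncons.
Proof. by move=> [a t]; congr pair; exact: val_inj. Qed.

Let measurable_uncons : measurable_fun setT uncons.
Proof.
apply/measurable_fun_pairP; split; first exact: measurable_tnth.
exact: measurable_behead.
Qed.

Lemma cons_measureX (A : set T) (B : set (N.-tuple T)) :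
  measurable A -> measurable B ->
  cons_measure [set x | A (thead x) /\ B [tuple of behead x]] =
    (lebesgue_measure A * mu B)%E.
Proof.
move=> mA mB; rewrite -product_measure1E//.
rewrite (_ : [set x | _] = uncons @^-1` (A `*` B))//.
rewrite /cons_measure /pushforward -comp_preimage.
by rewrite (_ : uncons \o cons_pair = id)//; exact/funext/cons_pairK.
Qed.

Let cons_measure_sigma_finite : sigma_finite setT cons_measure.
Proof.
have /sigma_finiteP[F [TF ndF Foo]] := sigma_finiteT (@lebesgue_measure R).
have /sigma_finiteP[G [TG ndG Goo]] := sigma_finiteT mu.
exists (fun k => [set x | F k (thead x) /\ G k [tuple of behead x]]).
  apply/seteqP; split=> // x _.
  have [n _ Fnx] : (\bigcup_k F k) (thead x) by rewrite -TF.
  have [k _ Gkx] : (\bigcup_k G k) [tuple of behead x] by rewrite -TG.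
  exists (maxn n k) => //; split.
    by move: Fnx; exact/subsetPset/ndF/leq_maxl.
  by move: Gkx; exact/subsetPset/ndG/leq_maxr.
move=> k; have [mF Fk] := Foo k; have [mG Gk] := Goo k; split.
  rewrite (_ : [set x | _] = uncons @^-1` (F k `*` G k))//.
  rewrite -[X in measurable X]setTI; apply: measurable_uncons => //.
  exact: measurableX.
by rewrite cons_measureX// lte_mul_pinfty// ge0_fin_numE.
Qed.

HB.instance Definition _ := Measure_isSigmaFinite.Build _ _ _ cons_measure
  cons_measure_sigma_finite.

End cons_measure.

Fixpoint lebesgue_rn (R : realType) (N : nat) :
    {sigma_finite_measure set (N.-tuple (measurableTypeR R)) -> \bar R} :=
  if N is N'.+1 then cons_measure (lebesgue_rn R N')
  else \d_([tuple] : 0.-tuple (measurableTypeR R)).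

Lemma lebesgue_rn_box (R : realType) (N : nat)
    (A : 'I_N -> set (measurableTypeR R)) :
  (forall i, measurable (A i)) ->
  lebesgue_rn R N [set x | forall i, A i (tnth x i)] =
    (\prod_(i < N) lebesgue_measure (A i))%E.
Proof.
elim: N A => [|N IHN] A mA.
  rewrite big_ord0 /= (_ : [set x | _] = setT) ?diracT//.
  by apply/seteqP; split=> // x _ [].
rewrite big_ord_recl -IHN// -cons_measureX//.
  congr (_ _); apply/seteqP; split=> x /=.
    move=> Ax; split=> [|i]; first exact: Ax.
    by have := Ax (lift ord0 i); rewrite {1}(tuple_eta x) tnthS.
  move=> [A0 Ax] i; case: (unliftP ord0 i) => [j ->|->//].
  by rewrite (tuple_eta x) tnthS.
rewrite (_ : [set x | _] = \bigcap_(i in [set: 'I_N]) ((@tnth _ _)^~ i @^-1` A (lift ord0 i))).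
  apply: fin_bigcap_measurable => // i _.
  by rewrite -[X in measurable X]setTI; exact: measurable_tnth.
by apply/seteqP; split=> x /= xA i; [move=> _|]; exact: xA.
Qed.

Definition is_domain {R : realType} (X : set R) : Prop :=
  [/\ X !=set0, open X & connected X].

Definition is_pdf {R : realType} (X : set R) (p : R -> R) : Prop :=
  (forall x, X x -> 0 <= p x) /\
  (\int[lebesgue_measure]_(x in X) (p x)%:E = 1)%E.

(* For open X this is continuous differentiability of the restriction of p to
   X; the values of p outside X are irrelevant.                               *)
Definition C1_on {R : realType} (X : set R) (p : R -> R) : Prop :=
  forall x, X x -> derivable p x 1 /\ {for x, continuous (derive1 p)}.

Definition pderiv {R : realType} {m : nat} (a : 'I_m) (f : 'rV[R]_m -> R)
  (theta : 'rV[R]_m) : R := 'D_(delta_mx 0 a) f theta.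

(* Logarithmic derivatives, set to 0 where the density vanishes (where ln is
   a junk value), so that the integrands below vanish there.                  *)
Definition dln {R : realType} (p : R -> R) (x : R) : R :=
  if p x == 0 then 0 else derive1 (fun y => ln (p y)) x.

Definition pderiv_ln {R : realType} {m : nat} (a : 'I_m)
    (f : 'rV[R]_m -> R) (theta : 'rV[R]_m) : R :=
  if f theta == 0 then 0 else pderiv a (fun t => ln (f t)) theta.

Definition fisher_integrand {R : realType} {m : nat} {T : Type}
    (P : T -> 'rV[R]_m -> R) (a b : 'I_m) (theta : 'rV[R]_m) (x : T) : R :=
  P x theta * pderiv_ln a (P x) theta * pderiv_ln b (P x) theta.

(* Rintegral takes the junk value 0 on a divergent integral, so finiteness of
   the component is a separate predicate.                                     *)
Definition fisher_finite {R : realType} {m N : nat}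
    (X : set (N.-tuple (measurableTypeR R)))
    (P : N.-tuple (measurableTypeR R) -> 'rV[R]_m -> R)
    (a b : 'I_m) (theta : 'rV[R]_m) : Prop :=
  (lebesgue_rn R N).-integrable X (EFin \o fisher_integrand P a b theta).

Definition fisher_metric {R : realType} {m N : nat}
    (X : set (N.-tuple (measurableTypeR R)))
    (P : N.-tuple (measurableTypeR R) -> 'rV[R]_m -> R)
    (a b : 'I_m) (theta : 'rV[R]_m) : R :=
  \int[lebesgue_rn R N]_(x in X) fisher_integrand P a b theta x.

Section translation_family.
Context {R : realType} {m n : nat}.
Variables (X : 'I_n -> set R) (p : 'I_n -> R -> R).
Variables (h : 'I_n -> 'rV[R]_m -> R) (e : 'I_n -> nat).

(* The pairs (i, k) with i < n and k < e i, indexing the spatial variables.   *)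
Definition copies : finType := {i : 'I_n & 'I_(e i)}.

Definition spatial_point : Type := #|copies|.-tuple (measurableTypeR R).

Definition coord (x : spatial_point) (j : copies) : R := tnth x (enum_rank j).

Definition product_domain : set spatial_point :=
  [set x | forall j : copies, X (tag j) (coord x j)].

Definition translation_family (x : spatial_point) (theta : 'rV[R]_m) : R :=
  \prod_(i < n) \prod_(k < e i)
    p i (coord x (Tagged (fun i => 'I_(e i)) k) - h i theta).

Definition D_integrand (i : 'I_n) (x : R) : R := derive1 (p i) x * dln (p i) x.

Definition D_coef (i j : 'I_n) : R :=
  if i == j then
    (e i)%:R * \int[lebesgue_measure]_(x in X i) D_integrand i x
  else 0.

End translation_family.

Arguments translation_family {R m n} p h e x theta.
Arguments product_domain {R n} X e.

(* Main.v *)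
Require Import Defs.
From HB Require Import structures.
From mathcomp Require Import all_boot all_order all_algebra.
From mathcomp Require Import all_classical all_reals all_analysis.
From mathcomp Require Import measurable_realfun ring lra.
Import Order.TTheory GRing.Theory Num.Theory.
Import numFieldNormedType.Exports.

Local Open Scope classical_set_scope.
Local Open Scope ring_scope.

(* The score of the product family is the sum over the copies j of
   - (d_a h_j) (ln p_j)'(x_j - h_j), so the Fisher integrand is a double sum over
   pairs of copies (j, k) of products of one-variable functions, which Fubini
   integrates factor by factor. The pairs j = k yield the diagonal D_ii. A pair
   j <> k contains the factor int_{X_j} p_j'. An interval invariant under a
   nonzero translation is the whole line, so either X_j = R, and this integral
   vanishes, or h_j = 0 on the open set M, and the coefficient d_a h_j vanishes. *)

(** * Translation invariance of Lebesgue measure and of the integral on the line *)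

Section shift_invariance.
Context {R : realType}.
Local Notation mu := (@lebesgue_measure R).

Lemma measurable_shift (c : R) :
  measurable_fun setT ((fun x => x + c) : measurableTypeR R -> measurableTypeR R).
Proof. by apply: measurable_funD; [exact: measurable_id|exact: measurable_cst]. Qed.

(** By uniqueness of Lebesgue measure it suffices to test intervals []a, b]]; their preimages []a -
    c, b - c]] have the same length. The translation is packed as a measurable-function structure so
    that its pushforward is recognised as a measure. *)
Lemma lebesgue_measure_shift (c : R) (A : set R) : measurable A ->
  pushforward mu ((fun x => x + c) : _ -> measurableTypeR R) A = mu A.
Proof.
move=> mA; pose mc := isMeasurableFun.Build _ _ _ _ _ (measurable_shift c).
pose shift : {mfun measurableTypeR R >-> measurableTypeR R} :=
  MeasurableFun.Pack (MeasurableFun.Class mc).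
apply/esym.
apply: (@lebesgue_measure_unique R (pushforward mu shift)) => //= _ [[a b]] _ <-.
rewrite /pushforward (_ : _ @^-1` _ = `]a - c, b - c]%classic).
  by rewrite !lebesgue_measure_itv/= !lte_fin ltrD2r -!EFinB opprB addrA subrK.
by apply/seteqP; split=> x /=; rewrite !in_itv/= ltrBlDr lerBrDr.
Qed.

(** The nonnegative case comes first because, applied to the absolute value of [f], it yields
    integrability of translates. *)
Lemma ge0_integral_shift (c : R) (f : R -> \bar R) :
  measurable_fun setT f -> (forall x, (0 <= f x)%E) ->
  (\int[mu]_x f (x + c)%R = \int[mu]_x f x)%E.
Proof.
move=> mf f0.
rewrite -[LHS](ge0_integral_pushforward (measurable_shift c) mu measurableT mf)//.
apply: eq_measure_integral; first exact: measurable_shift.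
by move=> mc A mA _; exact: lebesgue_measure_shift.
Qed.

Lemma integrable_shift (c : R) (f : R -> \bar R) : mu.-integrable setT f ->
  mu.-integrable setT (fun x => f (x + c)%R).
Proof.
move=> /integrableP[mf foo]; apply/integrableP; split.
  exact: (measurableT_comp mf (measurable_shift c)).
by rewrite (ge0_integral_shift c (fun x => `|f x|%E))//; exact: measurableT_comp.
Qed.

Lemma integral_shift (c : R) (f : R -> \bar R) : mu.-integrable setT f ->
  (\int[mu]_x f (x + c)%R = \int[mu]_x f x)%E.
Proof.
move=> intf; have /integrableP[mf _] := intf.
rewrite -[LHS](integral_pushforward (measurable_shift c) mf
  (integrable_shift c f intf) measurableT).
apply: eq_measure_integral; first exact: measurable_shift.
by move=> mc A mA _; exact: lebesgue_measure_shift.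
Qed.

End shift_invariance.

(** * Fubini for products of one-variable functions on R^N *)

Section product_integral.
Context {R : realType}.
Local Notation T := (measurableTypeR R).
Local Notation mu := (@lebesgue_measure R).

Lemma measurable_prod_tnth (N : nat) (f : 'I_N -> T -> R) :
  (forall i, measurable_fun setT (f i)) ->
  measurable_fun setT (fun x : N.-tuple T => \prod_(i < N) f i (tnth x i)).
Proof.
move=> mf; apply: measurable_prod => i _.
by apply: measurableT_comp (mf i) _; exact: measurable_tnth.
Qed.

(** Induction on [N]: pulled back along [cons_pair], the integrand is [f ord0] in the head times the
    remaining product in the tail, and Fubini separates the two. Integrability is carried along
    because Fubini requires it of the tail. *)
Lemma integral_prod_tnth (N : nat) (f : 'I_N -> T -> R) :
  (forall i, mu.-integrable setT (EFin \o f i)) ->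
  (lebesgue_rn R N).-integrable setT
    (EFin \o (fun x => \prod_(i < N) f i (tnth x i))) /\
  \int[lebesgue_rn R N]_x (\prod_(i < N) f i (tnth x i)) =
  \prod_(i < N) \int[mu]_x f i x.
Proof.
elim: N f => [|N IHN] f intf.
  under [X in EFin \o X]eq_fun do rewrite big_ord0.
  under eq_Rintegral do rewrite big_ord0.
  (* In dimension 0 the measure is a unit mass, so the empty product integrates to 1. *)
  have mass1 : lebesgue_rn R 0 setT = 1%E by exact: diracT.
  rewrite big_ord0; split; last first.
    by rewrite Rintegral_cst// mul1r; exact: (congr1 fine mass1).
  apply/integrableP; split; first exact: measurable_cst.
  under eq_integral do rewrite /= normr1.
  by rewrite integral_cst// mul1e [X in (X < _)%E](mass1 : _ = 1%E) ltry.
pose g (t : N.-tuple T) := \prod_(i < N) f (lift ord0 i) (tnth t i).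
have [intg Eg] := IHN (fun i => f (lift ord0 i)) (fun i => intf (lift ord0 i)).
rewrite -/g in intg Eg.
pose F (x : N.+1.-tuple T) := \prod_(i < N.+1) f i (tnth x i).
have mf i : measurable_fun setT (f i) by have /integrableP[/measurable_EFinP] := intf i.
have mg : measurable_fun setT g by have /integrableP[/measurable_EFinP] := intg.
have FE p : F (cons_pair p) = f ord0 p.1 * g p.2.
  rewrite /F big_ord_recl; congr (_ * _).
  by apply: eq_bigr => i _; rewrite tnthS; congr (f _ (tnth _ _)); exact: val_inj.
have mF : measurable_fun setT (EFin \o F).
  by apply/measurable_EFinP; exact: measurable_prod_tnth.
pose nu := (lebesgue_rn R N).
have mfg : measurable_fun setT (fun p : T * N.-tuple T => (f ord0 p.1 * g p.2)%:E).
  apply/measurable_EFinP; apply: measurable_funM.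
    by apply: measurableT_comp (mf ord0) _; exact: measurable_fst.
  by apply: measurableT_comp mg _; exact: measurable_snd.
have intfg : (mu \x nu)%E.-integrable setT (fun p => (f ord0 p.1 * g p.2)%:E).
  (* Tonelli's criterion: the iterated integral of the absolute value is the product of the two
     finite integrals of [|f ord0|] and [|g|]. *)
  apply/(integrable12ltyP _ _ mfg).
  rewrite (_ : (fun x => _) = (fun x => (`|f ord0 x|)%:E * \int[nu]_t (`|g t|)%:E)%E).
    rewrite ge0_integralZr//; last 2 first.
    - by apply/measurable_EFinP; exact: measurableT_comp.
    - exact: integral_ge0.
    apply: lte_mul_pinfty.
    - exact: integral_ge0.
    - rewrite ge0_fin_numE; last exact: integral_ge0.
      by have /integrableP[] := intf ord0.
    - by have /integrableP[] := intg.
  apply/funext => x/=; under eq_integral do rewrite normrM EFinM.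
  by rewrite ge0_integralZl//; apply/measurable_EFinP; exact: measurableT_comp.
have int2 : (mu \x nu)%E.-integrable setT ((EFin \o F) \o @cons_pair R N).
  by rewrite (_ : _ \o _ = fun p => (f ord0 p.1 * g p.2)%:E)//; apply/funext => p /=; rewrite FE.
split.
  exact: (integrable_pushforward (@measurable_cons_pair R N) mF int2 measurableT).
rewrite big_ord_recl -Eg /Rintegral.
have := integral_pushforward (@measurable_cons_pair R N) mF int2 measurableT.
rewrite preimage_setT => E.
rewrite -fineM; [|exact: (integrable_fin_num measurableT (intf ord0))
  |exact: (integrable_fin_num measurableT intg)].
congr fine; rewrite [LHS]E.
under eq_integral do rewrite /= FE.
rewrite -(integral12_prod_meas1 intfg) /fubini_F /=.
under eq_integral.
  move=> x _; under eq_integral do rewrite EFinM.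
  rewrite integralZl// -[X in (_ * X)%E]fineK; last exact: (integrable_fin_num measurableT intg).
  over.
rewrite integralZr//; last exact: (intf ord0).
by rewrite fineK//; exact: (integrable_fin_num measurableT intg).
Qed.

End product_integral.

(** * Directional derivatives of composites and finite products *)

Section log_derivative.
Context {R : realType} {V : normedModType R}.

Lemma derive_comp1 (f : V -> R) (g : R -> R) (x v : V) :
  differentiable f x -> derivable g (f x) 1 ->
  'D_v (g \o f) x = derive1 g (f x) * 'D_v f x.
Proof.
move=> df dg; have dg' : differentiable g (f x) by exact/derivable1_diffP.
rewrite !deriveE//; last exact: differentiable_comp.
by rewrite diff_comp//= diff1E// mulrC.
Qed.

(** Induction with the Leibniz rule; since no factor vanishes, each term can be written as the whole
    product times one logarithmic derivative. *)
Lemma log_derive_prod (I : Type) (s : seq I) (f : I -> V -> R) (x v : V) :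
  (forall i, differentiable (f i) x) -> (forall i, f i x != 0) ->
  differentiable (fun t => \prod_(i <- s) f i t) x /\
  'D_v (fun t => \prod_(i <- s) f i t) x =
    (\prod_(i <- s) f i x) * \sum_(i <- s) 'D_v (f i) x / f i x.
Proof.
move=> df f0; elim: s => [|i s [dP DP]].
  under eq_fun do rewrite big_nil.
  split; first exact: differentiable_cst.
  by rewrite !big_nil mulr0 derive_cst.
have -> : (fun t => \prod_(j <- i :: s) f j t) =
    f i * (fun t => \prod_(j <- s) f j t).
  by apply/funext => t; rewrite big_cons.
split; first exact: differentiableM.
rewrite deriveM; [|exact: diff_derivable..].
rewrite DP !big_cons mulrDr addrC; congr (_ + _).
  by rewrite [f i x * _]mulrC -mulrA [X in _ = _ * X]mulrC divfK.
by rewrite /GRing.scale/= mulrA.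
Qed.

End log_derivative.

(** * Translation-invariant domains and interior minima *)

Section real_line.
Context {R : realType}.
Local Notation mu := (@lebesgue_measure R).
Implicit Types (X : set R) (p : R -> R).

(** For [c] nonzero, iterating the invariance in both directions places [x0 - c *+ n] and
    [x0 + c *+ n] in [X] for every [n]; a connected set contains everything between them. *)
Lemma translate_domain X (c : R) : is_domain X ->
  [set x - c | x in X] = X -> X = setT \/ c = 0.
Proof.
move=> [[x0 Xx0] _ /connected_intervalP iX] XcX.
have [->|c0] := eqVneq c 0; [by right|left].
have Xm x : X x -> X (x - c) by move=> Xx; rewrite -XcX; exists x.
have Xp x : X x -> X (x + c).
  by rewrite -{1}XcX => -[y Xy <-]; rewrite subrK.
have Xmn x n : X x -> X (x - c *+ n).
  move=> Xx; elim: n => [|n IHn]; first by rewrite subr0.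
  by rewrite mulrSr opprD addrA; exact: Xm.
have Xpn x n : X x -> X (x + c *+ n).
  move=> Xx; elim: n => [|n IHn]; first by rewrite addr0.
  by rewrite mulrSr addrA; exact: Xp.
apply/seteqP; split=> // y _.
(* Archimedean choice of [n]: [y] lies within [|c| *+ n] of [x0]. The sign of [c *+ n] then decides
   which of the two translates is the left endpoint. *)
have [n] : exists n, `|y - x0| < `|c| *+ n.
  exists (Num.truncn (`|y - x0| / `|c|)).+1.
  by rewrite -mulr_natr -ltr_pdivrMl ?normr_gt0// mulrC truncnS_gt.
rewrite -normrMn ltr_norml => /andP[].
have [cn0|cn0] := leP 0 (c *+ n) => yl yr.
  apply: (iX (x0 - c *+ n) (x0 + c *+ n)); [exact: Xmn|exact: Xpn|].
  by move: yl yr; rewrite ger0_norm//; lra.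
apply: (iX (x0 + c *+ n) (x0 - c *+ n)); [exact: Xpn|exact: Xmn|].
by move: yl yr; rewrite ltr0_norm//; lra.
Qed.

Lemma derive1_open_min X p x : open X -> X x ->
  (forall y, X y -> derivable p y 1) ->
  (forall y, X y -> p x <= p y) -> derive1 p x = 0.
Proof.
move=> oX Xx dp px.
have /nbhs_ballP[e /= e0 xeX] : nbhs x X by exact: open_nbhs_nbhs.
have eX y : y \in `]x - e, x + e[ -> X y.
  move=> yxe; apply: xeX; rewrite /ball/= ltr_norml.
  by move: yxe; rewrite in_itv/=; lra.
rewrite derive1E; apply: derive_val.
apply: (@derive1_at_min _ p (x - e) (x + e)).
- by lra.
- by move=> t /eX/dp.
- by rewrite in_itv/=; lra.
- by move=> t /eX/px.
Qed.

(** * Continuously differentiable densities on an open set *)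

Section density.
Variables (X : set R) (p : R -> R).
Hypotheses (oX : open X) (p_pdf : is_pdf X p) (p_C1 : C1_on X p).
Hypothesis D_fin :
  mu.-integrable X (EFin \o (fun x => derive1 p x * dln p x)).

Let p_ge0 x : X x -> 0 <= p x. Proof. by case: p_pdf => + _ => /[apply]. Qed.

Let mX : measurable (X : set (measurableTypeR R)).
Proof. exact: open_measurable. Qed.

Lemma dlnE x : X x -> p x != 0 -> dln p x = derive1 p x / p x.
Proof.
move=> Xx px0; have {}px0 : 0 < p x by rewrite lt_neqAle eq_sym px0 p_ge0.
rewrite /dln gt_eqF// (@derive1_comp _ p (@ln R)).
- by rewrite derive1E (@derive_val _ _ _ _ _ _ _ (is_derive1_ln px0)) mulrC.
- by have [] := p_C1 _ Xx.
- exact: (@ex_derive _ _ _ _ _ _ _ (is_derive1_ln px0)).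
Qed.

(** At a zero of [p] the left side is 0; the right side is too, because the nonnegative [p] has a
    minimum there and [X] is open. *)
Lemma density_dln x : X x -> p x * dln p x = derive1 p x.
Proof.
move=> Xx; have [px0|px0] := eqVneq (p x) 0; last by rewrite dlnE// mulrC divfK.
rewrite px0 mul0r (@derive1_open_min X)//.
- by move=> y /p_C1[].
- by move=> y Xy; rewrite px0 p_ge0.
Qed.

Lemma density_dln2 x : X x ->
  p x * dln p x * dln p x = derive1 p x * dln p x.
Proof. by move=> Xx; rewrite density_dln. Qed.

Lemma measurable_density : measurable_fun X p.
Proof.
apply: open_continuous_measurable_fun => // x /set_mem Xx.
by apply/differentiable_continuous/derivable1_diffP; have [] := p_C1 _ Xx.
Qed.

Lemma measurable_density_derive : measurable_fun X (derive1 p).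
Proof.
by apply: open_continuous_measurable_fun => // x /set_mem Xx; have [] := p_C1 _ Xx.
Qed.

Lemma Rintegral_density : \int[mu]_(x in X) p x = 1.
Proof. by rewrite /Rintegral; have [_ ->] := p_pdf. Qed.

Lemma integrable_density : mu.-integrable X (EFin \o p).
Proof.
apply/integrableP; split; first by apply/measurable_EFinP; exact: measurable_density.
under eq_integral => x /set_mem Xx do rewrite /= ger0_norm ?p_ge0//.
by have [_ ->] := p_pdf; rewrite ltry.
Qed.

(* AM-GM: [2 p |s| <= p + p s^2] *)
Lemma integrable_density_derive : mu.-integrable X (EFin \o derive1 p).
Proof.
have := integrableD mX integrable_density D_fin; apply: le_integrable => //.
  by apply/measurable_EFinP; exact: measurable_density_derive.
move=> x Xx; rewrite /= lee_fin -density_dln2// -density_dln// -mulrA.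
have := p_ge0 _ Xx; move: (p x) (dln p x) => a s a0.
rewrite normrM (ger0_norm a0) (ger0_norm (x := _ + _)); last first.
  by rewrite addr_ge0// mulr_ge0// -expr2 sqr_ge0.
rewrite -[X in X + _]mulr1 -mulrDr ler_wpM2l//.
by rewrite -expr2 -real_normK ?num_real//; move: (normr_ge0 s); nra.
Qed.

End density.
End real_line.

(** * The integral of a derivative over the whole line *)

Section derivative_integral.
Context {R : realType}.
Local Notation mu := (@lebesgue_measure R).

(** The integral runs over the fixed interval [[0, 1]] instead of [[x, x + 1]], so that the domain
    of [t] does not depend on [x] when Fubini is applied. *)
Lemma FTC2_shift (p : R -> R) (x : R) :
  (forall x, derivable p x 1) -> continuous (derive1 p) ->
  (\int[mu]_(t in `[0%R, 1%R]) (derive1 p (x + t)%R)%:E = (p (x + 1) - p x)%R%:E)%E.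
Proof.
move=> dp cp'.
have cs : continuous (fun t : R => x + t).
  by move=> t; apply: cvgD; [exact: cvg_cst|exact: cvg_id].
have ds (t : R) : is_derive t (1 : R) (fun t : R => x + t) (1 : R).
  rewrite -[X in is_derive _ _ _ X]add0r.
  exact: is_deriveD.
have dpx (t : R) : derivable (fun t : R => p (x + t)) t 1.
  apply/derivable1_diffP; apply: (@differentiable_comp _ _ _ _ (fun t => x + t) p).
    by apply/derivable1_diffP; exact: ex_derive.
  exact/derivable1_diffP.
have cpx : continuous (fun t : R => p (x + t)).
  by move=> t; apply/differentiable_continuous/derivable1_diffP.
have cp'x : continuous (fun t : R => derive1 p (x + t)).
  by move=> t; apply: (@continuous_comp _ _ _ (fun t => x + t)); [exact: cs|exact: cp'].
have dpxE (t : R) : derive1 (fun t : R => p (x + t)) t = derive1 p (x + t).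
  rewrite (@derive1_comp _ (fun t => x + t) p); [|exact: ex_derive|exact: dp].
  by rewrite [X in _ * X]derive1E derive_val mulr1.
have := @continuous_FTC2 R (fun t => derive1 p (x + t)) (fun t => p (x + t)) 0 1.
rewrite addr0 EFinB; apply.
- exact: ltr01.
- exact: continuous_subspaceT.
- split; [by move=> t _|exact/cvg_at_right_filter/cpx|exact/cvg_at_left_filter/cpx].
- by move=> t _; exact: dpxE.
Qed.

(** After exchanging the integrals, the inner one in [x] equals the integral of [q] for each [t] by
    translation invariance, and [t] ranges over a set of mass 1. *)
Lemma Fubini_average (q : R -> R) (I : set (measurableTypeR R)) :
  mu.-integrable setT (EFin \o q) -> measurable I -> mu I = 1%E ->
  (\int[mu]_x \int[mu]_(t in I) (q (x + t)%R)%:E = \int[mu]_x (q x)%:E)%E.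
Proof.
move=> intq mI muI.
have intI : (\int[mu]_t (\1_I t)%:E = 1)%E.
  by rewrite integral_indic// setIT; exact: muI.
have mq : measurable_fun setT (q : measurableTypeR R -> R).
  by have /integrableP[/measurable_EFinP] := intq.
(* The indicator extends the [t]-integral to the whole line, so that Fubini applies to
   [mu \x mu]. *)
pose H (z : measurableTypeR R * measurableTypeR R) : \bar R :=
  (q (z.1 + z.2) * \1_I z.2)%:E.
have HE (x t : R) : H (x, t) = ((\1_I t)%:E * (q (x + t)%R)%:E)%E.
  by rewrite /H mulrC EFinM.
have mH : measurable_fun setT H.
  apply/measurable_EFinP; apply: measurable_funM.
    apply: (measurableT_comp mq).
    by apply: measurable_funD; [exact: measurable_fst|exact: measurable_snd].
  by apply: measurableT_comp; [exact: measurable_indic|exact: measurable_snd].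
have mabsq : measurable_fun setT (fun x : measurableTypeR R => `|q x|%:E).
  by apply/measurable_EFinP; exact: measurableT_comp.
have absHE (t : R) : (\int[mu]_x `|H (x, t)| =
    (\1_I t)%:E * \int[mu]_x `|q x|%:E)%E.
  rewrite -(ge0_integral_shift t (fun x => `|q x|%:E))//.
  rewrite -(@ge0_integralZl _ _ _ mu _ measurableT)//.
  - by apply: eq_integral => x _; rewrite HE abseM /= ger0_norm.
  - exact: (measurableT_comp mabsq (measurable_shift t)).
have intH : (mu \x mu)%E.-integrable setT H.
  apply/(integrable21ltyP _ _ mH).
  rewrite (_ : (fun t => _) =
      (fun t => (\1_I t)%:E * \int[mu]_x `|q x|%:E)%E); last first.
    by apply/funext => t; exact: absHE.
  rewrite ge0_integralZr//; last 2 first.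
  - by apply/measurable_EFinP; exact: measurable_indic.
  - exact: integral_ge0.
  by rewrite intI mul1e; have /integrableP[] := intq.
have intH2 (t : R) : (\int[mu]_x H (x, t) =
    (\1_I t)%:E * \int[mu]_x (q x)%:E)%E.
  rewrite -(integral_shift t (EFin \o q))//.
  rewrite -(@integralZl _ _ _ mu _ measurableT)//.
  - by apply: eq_integral => x _; rewrite HE.
  - exact: (integrable_shift t (EFin \o q)).
transitivity (\int[mu]_x \int[mu]_t H (x, t))%E.
  apply: eq_integral => x _; rewrite integral_mkcond.
  by apply: eq_integral => t _; rewrite epatch_indic/= HE muleC.
rewrite (Fubini intH).
rewrite (eq_integral (fun t => (\1_I t)%:E * \int[mu]_x (q x)%:E)%E); last first.
  by move=> t _; exact: intH2.
have /fineK <- : (\int[mu]_x (q x)%:E)%E \is a fin_num.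
  exact: (integrable_fin_num measurableT intq).
rewrite integralZr//; last first.
  apply/integrableP; split; first by apply/measurable_EFinP; exact: measurable_indic.
  by under eq_integral do rewrite /= ger0_norm//; rewrite intI ltry.
by rewrite intI mul1e.
Qed.

(* Average [p'] over unit translates: by Fubini, [int p'] is the integral over
   [x] of [p (x + 1) - p x], which vanishes by translation invariance. *)
Lemma Rintegral_derive1_eq0 (p : R -> R) :
  (forall x, derivable p x 1) -> continuous (derive1 p) ->
  mu.-integrable setT (EFin \o p) -> mu.-integrable setT (EFin \o derive1 p) ->
  \int[mu]_x derive1 p x = 0.
Proof.
move=> dp cp' intp intp'.
have mu01 : mu `[0, 1]%classic = 1%E.
  by rewrite lebesgue_measure_itv/= lte_fin ltr01 oppr0 adde0.
have := Fubini_average _ _ intp' (measurable_itv _) mu01.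
have -> : (\int[mu]_x \int[mu]_(t in `[0%R, 1%R]) (derive1 p (x + t)%R)%:E =
    \int[mu]_x ((p (x + 1)%R)%:E - (p x)%:E))%E.
  by apply: eq_integral => x _; rewrite -EFinB; exact: FTC2_shift.
rewrite integralB//; last exact: (integrable_shift 1 (EFin \o p)).
(* The two integrals agree by translation invariance, and their common value is finite, so the
   extended-real difference is 0. *)
rewrite (integral_shift 1 (EFin \o p) intp) subee.
  by rewrite /Rintegral => <-.
exact: (integrable_fin_num measurableT intp).
Qed.
End derivative_integral.

(** * Integrals of linear combinations, of products over a finite type, and of translates *)

Section lincomb.
Context {d : measure_display} {T : measurableType d} {R : realType}.
Variable mu : {measure set T -> \bar R}.

Lemma integral_lincomb (D : set T) (I : Type) (s : seq I) (c : I -> R)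
    (f : I -> T -> R) : measurable D ->
  (forall i, mu.-integrable D (EFin \o f i)) ->
  mu.-integrable D (EFin \o (fun x => \sum_(i <- s) c i * f i x)) /\
  \int[mu]_(x in D) (\sum_(i <- s) c i * f i x) =
    \sum_(i <- s) c i * \int[mu]_(x in D) f i x.
Proof.
move=> mD intf; elim: s => [|i s [ints Es]].
  under [X in EFin \o X]eq_fun do rewrite big_nil.
  under eq_Rintegral do rewrite big_nil.
  rewrite big_nil; split; first exact: integrable0.
  by rewrite Rintegral_cst// mul0r.
have intci : mu.-integrable D (EFin \o (fun x => c i * f i x)).
  exact: (integrableZl mD (c i) (intf i)).
under [X in EFin \o X]eq_fun do rewrite big_cons.
under eq_Rintegral do rewrite big_cons.
split; first exact: (integrableD mD intci ints).
by rewrite RintegralD// big_cons Es RintegralZl.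
Qed.

End lincomb.

Section prod_coord.
Context {R : realType}.
Local Notation T := (measurableTypeR R).
Local Notation mu := (@lebesgue_measure R).

(** Reindexing along [enum_val] carries the product formula from ordinals to any finite index type,
    in particular the type of copies. *)
Lemma integral_prod_coord (J : finType) (f : J -> T -> R) :
  (forall j, mu.-integrable setT (EFin \o f j)) ->
  (lebesgue_rn R #|J|).-integrable setT
    (EFin \o (fun x => \prod_(j : J) f j (tnth x (enum_rank j)))) /\
  \int[lebesgue_rn R #|J|]_x (\prod_(j : J) f j (tnth x (enum_rank j))) =
  \prod_(j : J) \int[mu]_x f j x.
Proof.
move=> intf.
have [] := @integral_prod_tnth R #|J| (fun r => f (enum_val r)) (fun r => intf _).
have -> : (fun x : #|J|.-tuple T => \prod_(r < #|J|) f (enum_val r) (tnth x r)) =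
    (fun x => \prod_(j : J) f j (tnth x (enum_rank j))).
  apply/funext => x; rewrite [RHS](reindex _ (onW_bij _ (@enum_val_bij J))).
  by apply: eq_bigr => r _; rewrite enum_valK.
move=> intP EP; split=> //; by rewrite [RHS](reindex _ (onW_bij _ (@enum_val_bij J))).
Qed.

End prod_coord.

Section translate.
Context {R : realType}.
Local Notation mu := (@lebesgue_measure R).

(** Extending [w] by zero outside [X] moves the integral to the whole line, where translation
    invariance applies. *)
Lemma integral_patch_shift (X : set (measurableTypeR R)) (w : R -> R) (c : R) :
  measurable X -> mu.-integrable X (EFin \o w) ->
  mu.-integrable setT (EFin \o (fun x => (w \_ X) (x - c))) /\
  \int[mu]_x (w \_ X) (x - c) = \int[mu]_(x in X) w x.
Proof.
move=> mX intw.
have intwX : mu.-integrable setT (EFin \o (w \_ X)).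
  by have := iffLR (@integrable_mkcond _ _ _ mu X (EFin \o w) mX) intw; rewrite restrict_EFin.
split; first exact: (integrable_shift (- c) _ intwX).
rewrite [RHS]Rintegral_mkcond /Rintegral; congr fine.
exact: (integral_shift (- c) _ intwX).
Qed.

End translate.

(** * Score and Fisher metric of the translation family *)

Section fisher.
Context {R : realType} {m n : nat}.
Variables (M : set 'rV[R]_m) (X : 'I_n -> set R) (p : 'I_n -> R -> R).
Variables (h : 'I_n -> 'rV[R]_m -> R) (e : 'I_n -> nat).
Hypotheses (M_open : open M) (X_domain : forall i, is_domain (X i)).
Hypotheses (p_pdf : forall i, is_pdf (X i) (p i)).
Hypotheses (p_C1 : forall i, C1_on (X i) (p i)).
Hypothesis h_diff : forall i theta, M theta -> differentiable (h i) theta.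
Hypothesis X_inv : forall i theta, M theta ->
  [set x - h i theta | x in X i] = X i.
Hypothesis D_finite : forall i, lebesgue_measure.-integrable (X i)
  (EFin \o D_integrand p i).

Local Notation mu := (@lebesgue_measure R).
Local Notation J := (copies e).

Let oX i : open (X i). Proof. by have [] := X_domain i. Qed.

Let X_shift i (theta : 'rV[R]_m) (x : R) : M theta ->
  X i (x - h i theta) <-> X i x.
Proof.
move=> Mt; split=> [|Xx]; last by rewrite -(X_inv i _ Mt); exists x.
by rewrite -{1}(X_inv i _ Mt) => -[y Xy /addIr <-].
Qed.

Lemma translation_familyE (x : spatial_point e) (theta : 'rV[R]_m) :
  translation_family p h e x theta =
  \prod_(j : J) p (tag j) (Defs.coord x j - h (tag j) theta).
Proof.
rewrite /translation_family sig_big_dep/=.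
by apply: eq_bigr => -[i k] _.
Qed.

(** Where the family is nonzero, all factors are positive; the derivative of [ln] cancels the
    product in [log_derive_prod], and the inner function [x_j - h_j] contributes the minus sign. *)
Lemma pderiv_ln_translation (a : 'I_m) (x : spatial_point e)
    (theta : 'rV[R]_m) :
  M theta -> product_domain X e x -> translation_family p h e x theta != 0 ->
  pderiv_ln a (translation_family p h e x) theta =
  \sum_(j : J) - pderiv a (h (tag j)) theta *
    dln (p (tag j)) (Defs.coord x j - h (tag j) theta).
Proof.
move=> Mt Dx P0.
have Xu j : X (tag j) (Defs.coord x j - h (tag j) theta) by apply/X_shift => //; exact: Dx.
pose f (j : J) (t : 'rV[R]_m) : R := p (tag j) (Defs.coord x j - h (tag j) t).
have PE : translation_family p h e x = (fun t => \prod_(j : J) f j t).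
  by apply/funext => t; rewrite translation_familyE.
have f0 j : f j theta != 0.
  by move: P0; rewrite PE => /prodf_neq0; exact.
have fge0 j : 0 <= f j theta by have [+ _] := p_pdf (tag j); apply.
have dlin j : differentiable (fun t => Defs.coord x j - h (tag j) t) theta.
  by apply: differentiableB => //; exact: h_diff.
have dp j : derivable (p (tag j)) (Defs.coord x j - h (tag j) theta) 1.
  by have [] := p_C1 (tag j) _ (Xu j).
have df j : differentiable (f j) theta.
  apply: (differentiable_comp (dlin j)); exact/derivable1_diffP.
rewrite /pderiv_ln (negbTE P0) /pderiv PE.
have [dP DP] := log_derive_prod J (index_enum J) f theta (delta_mx 0 a) df f0.
have P_gt0 : 0 < \prod_(j : J) f j theta.
  by apply: prodr_gt0 => j _; rewrite lt_neqAle eq_sym f0 fge0.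
rewrite (derive_comp1 (fun t => \prod_(j : J) f j t) (@ln R))//; last first.
  exact: (@ex_derive _ _ _ _ _ _ _ (is_derive1_ln P_gt0)).
rewrite derive1E (@derive_val _ _ _ _ _ _ _ (is_derive1_ln P_gt0)) DP.
rewrite mulKf ?gt_eqF//; apply: eq_bigr => j _.
rewrite (dlnE _ _ (p_pdf _) (p_C1 _) _ (Xu j) (f0 j)).
rewrite (derive_comp1 (fun t => Defs.coord x j - h (tag j) t) (p (tag j)))//.
rewrite deriveB//; last exact/diff_derivable/h_diff.
by rewrite derive_cst sub0r mulrAC mulrC.
Qed.

Lemma pderiv_shift0 (i : 'I_n) (a : 'I_m) (theta : 'rV[R]_m) :
  M theta -> X i <> setT -> pderiv a (h i) theta = 0.
Proof.
move=> Mt XT; have h0 t : M t -> h i t = 0.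
  by move=> Mt'; have [] := translate_domain _ _ (X_domain i) (X_inv i t Mt').
(* Since [M] is open, [h i] coincides with the constant 0 near [theta]. *)
rewrite /pderiv (@near_eq_derive _ _ _ (h i) (cst 0)) ?derive_cst//.
have : nbhs theta M by exact: open_nbhs_nbhs.
by apply: filterS => t /h0.
Qed.

Variable theta : 'rV[R]_m.
Hypothesis Mtheta : M theta.

Let mX i : measurable (X i : set (measurableTypeR R)).
Proof. exact: open_measurable. Qed.

(* The (j, k) term of the integrand factors over the copies l; only the factors
   at j and k carry a logarithmic derivative. *)
Definition marginal_factor (j k l : J) (u : R) : R :=
  p (tag l) u * (if l == j then dln (p (tag l)) u else 1)
              * (if l == k then dln (p (tag l)) u else 1).

Lemma marginal_factorE (j k l : J) (u : R) : X (tag l) u ->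
  marginal_factor j k l u =
  if l == j then if l == k then D_integrand p (tag l) u
                 else derive1 (p (tag l)) u
  else if l == k then derive1 (p (tag l)) u else p (tag l) u.
Proof.
move=> Xu; rewrite /marginal_factor /D_integrand.
have pdln := density_dln _ _ (oX _) (p_pdf _) (p_C1 _) u Xu.
by case: (l == j); case: (l == k); rewrite ?mulr1 ?pdln.
Qed.

(** With zero, one or two logarithmic derivatives the factor is the density, its derivative
    (integrable by the AM-GM bound) or the integrand of [D_coef] (integrable by hypothesis). *)
Lemma integrable_marginal_factor (j k l : J) :
  mu.-integrable (X (tag l)) (EFin \o marginal_factor j k l).
Proof.
have intp := integrable_density _ _ (oX _) (p_pdf (tag l)) (p_C1 _).
have intp' := integrable_density_derive _ _ (oX _) (p_pdf (tag l)) (p_C1 _) (D_finite _).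
apply: (@eq_integrable _ _ _ _ _ (mX _) (EFin \o (fun u =>
  if l == j then if l == k then D_integrand p (tag l) u
                 else derive1 (p (tag l)) u
  else if l == k then derive1 (p (tag l)) u else p (tag l) u))).
  by move=> u /set_mem Xu; rewrite /= marginal_factorE.
by case: (l == j); case: (l == k).
Qed.

Lemma Rintegral_marginal_factor_neq (j k : J) : j != k -> X (tag j) = setT ->
  \int[mu]_(u in X (tag j)) marginal_factor j k j u = 0.
Proof.
move=> jk XT.
transitivity (\int[mu]_(u in X (tag j)) derive1 (p (tag j)) u).
  apply: eq_Rintegral.
  by move=> u /set_mem Xu; rewrite marginal_factorE// eqxx (negbTE jk).
have := p_C1 (tag j); have := integrable_density _ _ (oX _) (p_pdf (tag j)) (p_C1 _).
have := integrable_density_derive _ _ (oX _) (p_pdf (tag j)) (p_C1 _) (D_finite _).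
rewrite XT => intp' intp pC1; apply: Rintegral_derive1_eq0 => //.
- by move=> u; have [] := pC1 u I.
- by move=> u; have [] := pC1 u I.
Qed.

Lemma Rintegral_marginal_factor_other (j k l : J) : l != j -> l != k ->
  \int[mu]_(u in X (tag l)) marginal_factor j k l u = 1.
Proof.
move=> lj lk; rewrite -(Rintegral_density _ _ (p_pdf (tag l))).
apply: eq_Rintegral => u /set_mem Xu.
by rewrite marginal_factorE// (negbTE lj) (negbTE lk).
Qed.

(** The coefficients are kept in the statement because, for distinct [j] and [k], what vanishes
    depends on the domain: the integral at [j] if [X (tag j)] is the line, the derivative of
    [h (tag j)] otherwise. *)
Lemma prod_Rintegral_marginal_factor (a b : 'I_m) (j k : J) :
  pderiv a (h (tag j)) theta * pderiv b (h (tag k)) theta *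
    \prod_(l : J) \int[mu]_(u in X (tag l)) marginal_factor j k l u =
  if j == k then pderiv a (h (tag j)) theta * pderiv b (h (tag j)) theta *
    \int[mu]_(u in X (tag j)) D_integrand p (tag j) u else 0.
Proof.
have [<-{k}|jk] := eqVneq j k.
  congr (_ * _); rewrite (bigD1 j)//= [X in _ * X]big1 ?mulr1.
    by apply: eq_Rintegral => u /set_mem Xu; rewrite marginal_factorE// eqxx.
  by move=> l lj; exact: Rintegral_marginal_factor_other.
have [XT|XT] := pselect (X (tag j) = setT); last first.
  by rewrite pderiv_shift0// !mul0r.
by rewrite (bigD1 j)//= Rintegral_marginal_factor_neq// mul0r mulr0.
Qed.

Lemma measurable_product_domain : measurable (product_domain X e).
Proof.
rewrite (_ : product_domain X e = \bigcap_(j in [set: J])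
  ((fun x : spatial_point e => tnth x (enum_rank j)) @^-1` X (tag j))); last first.
  by apply/seteqP; split=> x Dx j; [move=> _|]; exact: Dx.
apply: fin_bigcap_measurable => // j _.
by rewrite -[X in measurable X]setTI; apply: measurable_tnth => //; exact: mX.
Qed.

(** The product of two scores expands into a double sum in which the minus signs cancel. Outside the
    product domain some coordinate leaves its [X]; by invariance so does its translate, and the
    zero-extended factor kills every term. *)
Lemma fisher_integrand_patch (a b : 'I_m) (x : spatial_point e) :
  (fisher_integrand (translation_family p h e) a b theta \_
     (product_domain X e)) x =
  \sum_(jk : J * J)
    pderiv a (h (tag jk.1)) theta * pderiv b (h (tag jk.2)) theta *
    \prod_(l : J) (marginal_factor jk.1 jk.2 l \_ (X (tag l)))
      (Defs.coord x l - h (tag l) theta).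
Proof.
rewrite patchE; case: ifPn => [/set_mem Dx|/negP Dx]; last first.
  rewrite big1// => -[j k] _ /=.
  have [l Xl] : exists l : J, ~ X (tag l) (Defs.coord x l).
    by apply/existsNP => Xx; apply: Dx; exact/mem_set.
  rewrite (bigD1 l)//= patchE memNset ?mul0r ?mulr0//.
  by move=> /(X_shift _ _ _ Mtheta).
have Xu j : X (tag j) (Defs.coord x j - h (tag j) theta) by apply/X_shift => //; exact: Dx.
have prodE j k : \prod_(l : J) (marginal_factor j k l \_ (X (tag l)))
      (Defs.coord x l - h (tag l) theta) =
    translation_family p h e x theta *
    dln (p (tag j)) (Defs.coord x j - h (tag j) theta) *
    dln (p (tag k)) (Defs.coord x k - h (tag k) theta).
  under eq_bigr => l _ do rewrite patchE mem_set//.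
  (* The product splits into the product of the densities and two products of conditionals, each
     reduced to its single nontrivial factor. *)
  by rewrite !big_split/= -translation_familyE -!big_mkcond/= !big_pred1_eq.
under eq_bigr do rewrite prodE.
(* At a zero of the family both sides carry the factor 0; elsewhere the score formula is
   available. *)
have [P0|P0] := eqVneq (translation_family p h e x theta) 0.
  rewrite /fisher_integrand P0 !mul0r big1// => jk _.
  by rewrite !mul0r mulr0.
rewrite /fisher_integrand !pderiv_ln_translation// -mulrA big_distrlr/=.
rewrite pair_big/= mulr_sumr; apply: eq_bigr => -[j k] _ /=.
by ring.
Qed.

(** Extended by zero, the integrand is a finite sum of products of one-variable functions,
    integrated term by term; only pairs with [j = k] survive, leaving a sum over copies. *)
Lemma fisher_translation (a b : 'I_m) :
  fisher_finite (product_domain X e) (translation_family p h e) a b theta /\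
  fisher_metric (product_domain X e) (translation_family p h e) a b theta =
  \sum_(j : J) pderiv a (h (tag j)) theta * pderiv b (h (tag j)) theta *
    \int[mu]_(u in X (tag j)) D_integrand p (tag j) u.
Proof.
pose c (jk : J * J) :=
  pderiv a (h (tag jk.1)) theta * pderiv b (h (tag jk.2)) theta.
pose f (jk : J * J) (l : J) (x : R) :=
  (marginal_factor jk.1 jk.2 l \_ (X (tag l))) (x - h (tag l) theta).
have intf jk l := integral_patch_shift _ _ (h (tag l) theta) (mX (tag l))
  (integrable_marginal_factor jk.1 jk.2 l).
have intW jk := integral_prod_coord J (f jk) (fun l => (intf jk l).1).
have [intS ES] := integral_lincomb (lebesgue_rn R #|J|) setT _ (index_enum _) c
  _ measurableT (fun jk => (intW jk).1).
have FE : fisher_integrand (translation_family p h e) a b theta \_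
    (product_domain X e) = (fun x => \sum_(jk : J * J) c jk *
      \prod_(l : J) f jk l (tnth x (enum_rank l))).
  by apply/funext => x; exact: fisher_integrand_patch.
split.
  apply/(integrable_mkcond _ measurable_product_domain).
  by rewrite restrict_EFin FE.
rewrite /fisher_metric Rintegral_mkcond FE ES.
rewrite [LHS](eq_bigr (fun jk : J * J => if jk.1 == jk.2 then
    pderiv a (h (tag jk.1)) theta * pderiv b (h (tag jk.1)) theta *
    \int[mu]_(u in X (tag jk.1)) D_integrand p (tag jk.1) u else 0)); last first.
  move=> jk _; rewrite -prod_Rintegral_marginal_factor (intW jk).2.
  by congr (_ * _); apply: eq_bigr => l _; exact: (intf jk l).2.
rewrite -(pair_bigA _ (fun j k => if j == k then
    pderiv a (h (tag j)) theta * pderiv b (h (tag j)) theta *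
    \int[mu]_(u in X (tag j)) D_integrand p (tag j) u else 0))/=.
apply: eq_bigr => j _.
by rewrite -big_mkcond/= (big_pred1 j)// => k; rewrite eq_sym.
Qed.

End fisher.

Theorem corollary4p6 (R : realType) (m n : nat)
  (M : set 'rV[R]_m) (X : 'I_n -> set R) (p : 'I_n -> R -> R)
  (h : 'I_n -> 'rV[R]_m -> R) (e : 'I_n -> nat)
  (M_open : open M)
  (X_domain : forall i, is_domain (X i))
  (p_pdf : forall i, is_pdf (X i) (p i))
  (p_C1 : forall i, C1_on (X i) (p i))
  (h_diff : forall i theta, M theta -> differentiable (h i) theta)
  (e_gt0 : forall i, (0 < e i)%N)
  (X_inv : forall i theta, M theta ->
    [set x - h i theta | x in X i] = X i)
  (D_finite : forall i, lebesgue_measure.-integrable (X i)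
    (EFin \o D_integrand p i)) :
  forall (theta : 'rV[R]_m) (a b : 'I_m), M theta ->
    fisher_finite (product_domain X e) (translation_family p h e)
      a b theta /\
    fisher_metric (product_domain X e) (translation_family p h e)
      a b theta =
    \sum_(i < n) \sum_(j < n)
      pderiv a (h i) theta * pderiv b (h j) theta * D_coef X p e i j.
Proof.
move=> theta a b Mt.
have [fin ->] := fisher_translation M X p h e M_open X_domain p_pdf p_C1 h_diff
  X_inv D_finite theta Mt a b.
split=> //; transitivity (\sum_(i < n) \sum_(k < e i)
  pderiv a (h i) theta * pderiv b (h i) theta *
    \int[lebesgue_measure]_(u in X i) D_integrand p i u).
  by rewrite sig_big_dep/=; apply: eq_bigr => -[].
apply: eq_bigr => i _.
(* The [e i] equal terms supply the factor in [D_coef]; of the sum over [j] only [j = i] remains. *)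
rewrite sumr_const card_ord (bigD1 i)//= big1 ?addr0 => [|j ji].
  by rewrite /D_coef eqxx mulrCA mulr_natl.
by rewrite /D_coef eq_sym (negbTE ji) mulr0.
Qed.
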